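(* Let $t$ be a full binary tree. (a) The generating function $G_t(x)$ can be computed recursively as follows. (i) If $t=\bullet$, then $G_\bullet(x)=\frac12(e^{2x}-1)$. (ii) If $|t|>1$, and the root of $t$ has left and right subtrees $t_{\mathsf L}$ and $t_{\mathsf R}$, then $$G_t(x)=\int_0^x G_{t_{\mathsf L}}(y)G_{t_{\mathsf R}}(y)e^{2(x-y)}\,dy.$$ (b) The constant $\hat\beta_t$ is given by: (i) If $|t|=1$, i.e., $t=\bullet$, then $\hat\beta_t=1/3$. (ii) If $|t|>1$, and the root of $t$ has left and right subtrees $t_{\mathsf L}$ and $t_{\mathsf R}$, then $$\hat\beta_t=\int_0^1(1-x)^2G_{t_{\mathsf L}}(x)G_{t_{\mathsf R}}(x)\,dx.$$
   Context: Trees. A binary tree is a (finite, non-empty) rooted tree in which each child is labelled left or right and each node has at most one left and at most one right child. It is full if each node has outdegree 0 or 2. $|T|$ is the number of nodes; $\bullet$ is the tree with one node. For $v\in T$, the fringe tree $T^v$ consists of $v$ and all its descendants, and $N_t(T):=|\{v\in T:T^v=t\}|$ (equality as binary trees). The compression $\widehat T$ of a binary tree $T$ is the full binary tree obtained by deleting all nodes of outdegree 1 and connecting the remaining nodes in the obvious way. Binary search tree. The random binary search tree $\mathcal B_n$ is defined recursively from $n$ distinct real numbers: $\mathcal B_0$ is empty, $\mathcal B_1=\bullet$, and for $n\ge2$ a uniformly random one of the numbers (the pivot) is chosen at the root, and the left and right subtrees of the root are constructed recursively, independently, from the set of numbers smaller, respectively larger, than the pivot. $\widehat{\mathcal B}_n$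 is the compression of $\mathcal B_n$. For a full binary tree $t$, $\hat\beta_t$ is the (existing) constant such that, as $n\to\infty$, $(N_t(\widehat{\mathcal B}_n)-n\hat\beta_t)/\sqrt n$ converges in distribution to a centred normal distribution; in particular $\hat\beta_t$ is the limit in probability of $N_t(\widehat{\mathcal B}_n)/n$. Generating functions. For a binary tree $T$ let $p_T:=\mathbb{P}(\mathcal B_{|T|}=T)$ and $F_T(x):=p_Tx^{|T|}$; for a set $\mathfrak T_0$ of binary trees let $F_{\mathfrak T_0}(x):=\sum_{T\in\mathfrak T_0}F_T(x)$. For a full binary tree $t$, $G_t(x):=F_{\check{\mathfrak T}^+_t}(x)$, where $\check{\mathfrak T}^+_t$ is the set of all binary trees $T$ with $\widehat T=t$. *)

(* Defs.v *)
From HB Require Import structures.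
From mathcomp Require Import all_boot all_order all_algebra.
From mathcomp Require Import all_classical all_reals all_analysis.

Set Implicit Arguments.
Unset Strict Implicit.
Unset Printing Implicit Defensive.

Import Order.TTheory GRing.Theory Num.Theory.
Import numFieldNormedType.Exports.

Local Open Scope classical_set_scope.
Local Open Scope ring_scope.

(* Possibly empty binary trees.  A binary tree in the sense of the text (a
   non-empty one) is a [Node l r]; an [Empty] argument stands for the absence
   of the left, respectively right, child of the root. *)
Inductive bintree : Type := Empty | Node of bintree & bintree.

Fixpoint bintree_encode (T : bintree) : GenTree.tree unit :=
  match T with
  | Empty => GenTree.Leaf tt
  | Node l r => GenTree.Node 0 [:: bintree_encode l; bintree_encode r]
  end.

Fixpoint bintree_decode (g : GenTree.tree unit) : option bintree :=
  match g with
  | GenTree.Leaf _ => Some Empty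
  | GenTree.Node _ [:: gl; gr] =>
      if bintree_decode gl is Some l then
        if bintree_decode gr is Some r then Some (Node l r) else None
      else None
  | _ => None
  end.

Lemma bintree_encodeK : pcancel bintree_encode bintree_decode.
Proof. by elim=> //= l -> r ->. Qed.

HB.instance Definition _ := Countable.copy bintree (pcan_type bintree_encodeK).
HB.instance Definition _ := isPointed.Build bintree Empty.
HB.instance Definition _ := @isMeasurable.Build default_measure_display
  bintree discrete_measurable discrete_measurable0
  discrete_measurableC discrete_measurableU.

Definition bullet : bintree := Node Empty Empty.

Fixpoint nodes (T : bintree) : nat :=
  match T with Empty => 0 | Node l r => (nodes l + nodes r).+1 end.

Fixpoint is_full (T : bintree) : bool :=
  match T with
  | Empty => false
  | Node Empty Empty => true
  | Node l r => is_full l && is_full r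
  end.

Fixpoint fringe_trees (T : bintree) : seq bintree :=
  match T with
  | Empty => [::]
  | Node l r => Node l r :: fringe_trees l ++ fringe_trees r
  end.

Definition N (t T : bintree) : nat := count_mem t (fringe_trees T).

Fixpoint compress (T : bintree) : bintree :=
  match T with
  | Empty => Empty
  | Node Empty Empty => bullet
  | Node Empty r => compress r
  | Node l Empty => compress l
  | Node l r => Node (compress l) (compress r)
  end.

(* [bst_pmf s T] is the probability that the random binary search tree built
   from the (distinct) numbers in s equals T. *)
Fixpoint bst_pmf (R : realType) (s : seq R) (T : bintree) : R :=
  match T with
  | Empty => (s == [::])%:R
  | Node l r => (size s)%:R^-1 *
      \sum_(x <- s) bst_pmf [seq y <- s | y < x] l
                    * bst_pmf [seq y <- s | x < y] r
  end.

Lemma bst_pmf_ge0 (R : realType) (s : seq R) T : 0 <= bst_pmf s T.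
Proof.
elim: T s => [|l IHl r IHr] s /=; first by rewrite ler0n.
by rewrite mulr_ge0 ?invr_ge0 ?ler0n ?sumr_ge0// => x _; rewrite mulr_ge0.
Qed.

Lemma ge0_esumZl (R : realType) (I : choiceType) (A : set I) (c : R)
    (f : I -> \bar R) : 0 <= c -> (forall i, 0 <= f i)%E ->
  (\esum_(i in A) (c%:E * f i) = c%:E * \esum_(i in A) f i)%E.
Proof.
move=> c0 f0; rewrite /esum -ereal_supZl//; last first.
  apply/set0P; exists (\sum_(i \in set0) f i)%E.
  by exists set0 => //; exact: fsets_set0.
congr ereal_sup; rewrite image_comp; apply: eq_imagel => X _ /=.
by rewrite ge0_mule_fsumr.
Qed.

Lemma esum_bst_pmf (R : realType) (s : seq R) :
  (\esum_(T in [set: bintree]) (bst_pmf s T)%:E = 1)%E.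
Proof.
have [n] := ubnP (size s); elim: n s => // n IHn s /ltnSE-sn.
have p0 s' T : (0 <= (@bst_pmf R s' T)%:E)%E by rewrite lee_fin bst_pmf_ge0.
rewrite (esumID [set Empty])// !setTI esum_set1//.
have -> : ~` [set Empty] = [set Node u.1 u.2 | u in [set: bintree * bintree]].
  by apply/seteqP; split=> [[|l r]//= _|T [[l r] _ <-]//]; exists (l, r).
rewrite (esum_image setT); last by move=> [a b] [c d] _ _ [-> ->].
under eq_esum do rewrite /= mulr_sumr -sumEFin.
rewrite esum_sum; last first.
  by move=> u x _ _; rewrite lee_fin !mulr_ge0 ?bst_pmf_ge0 ?invr_ge0.
rewrite (eq_big_seq (fun=> (size s)%:R^-1%:E)); last first.
  move=> x xs.
  have H (a : pred R) : ~~ a x ->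
      (\esum_(T in [set: bintree]) (bst_pmf [seq y <- s | a y] T)%:E = 1)%E.
    move=> ax; apply: IHn; apply: leq_trans sn.
    rewrite size_filter -(count_predC a s) -[X in (X < _)%N]addn0 ltn_add2l.
    by rewrite -has_count; apply/hasP; exists x.
  have Hl : (\esum_(T in [set: bintree])
      (bst_pmf [seq y <- s | (y < x)%R] T)%:E = 1)%E by apply: H; rewrite ltxx.
  have Hr : (\esum_(T in [set: bintree])
      (bst_pmf [seq y <- s | (x < y)%R] T)%:E = 1)%E by apply: H; rewrite ltxx.
  have -> : [set: bintree * bintree] = [set: bintree] `*`` (fun=> [set: bintree]).
    by apply/seteqP; split.
  rewrite -(esum_esum (J := fun=> setT) (a := fun l r => ((size s)%:R^-1 *
      (bst_pmf [seq y <- s | (y < x)%R] l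
       * bst_pmf [seq y <- s | (x < y)%R] r))%:E)); last first.
    by move=> l r _ _; rewrite lee_fin !mulr_ge0 ?bst_pmf_ge0 ?invr_ge0.
  under eq_esum => l _.
    under eq_esum do rewrite mulrA EFinM.
    rewrite ge0_esumZl// ?mulr_ge0 ?invr_ge0 ?bst_pmf_ge0// Hr mule1 EFinM.
    over.
  by rewrite ge0_esumZl ?invr_ge0// Hl mule1.
case: s sn => [|x s] sn /=; first by rewrite big_nil adde0.
rewrite add0e sumEFin big_const_seq count_predT iter_addr_0.
by rewrite -[_ *+ _]mulr_natr mulVf// pnatr_eq0.
Qed.

Section bst_law.
Context (R : realType) (s : seq R).

Definition bst_law (A : set bintree) : \bar R :=
  (\esum_(T in A) (bst_pmf s T)%:E)%E.

Let bst_law0 : bst_law set0 = 0%E. Proof. exact: esum_set0. Qed.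

Let bst_law_ge0 A : (0 <= bst_law A)%E.
Proof. by apply: esum_ge0 => T _; rewrite lee_fin bst_pmf_ge0. Qed.

Let bst_law_sigma_additive : semi_sigma_additive bst_law.
Proof.
move=> F _ tF _; rewrite /bst_law nneseries_sum_bigcup//; last first.
  by move=> T; rewrite lee_fin bst_pmf_ge0.
by apply: is_cvg_nneseries => n _ _; exact: bst_law_ge0.
Qed.

HB.instance Definition _ := isMeasure.Build _ _ _ bst_law
  bst_law0 bst_law_ge0 bst_law_sigma_additive.

Let bst_law_setT : bst_law setT = 1%E. Proof. exact: esum_bst_pmf. Qed.

HB.instance Definition _ :=
  Measure_isProbability.Build _ _ _ bst_law bst_law_setT.

End bst_law.

(* The law of the random binary search tree with n nodes; it does not depend
   on the choice of the n distinct numbers, which are taken to be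
   0, ..., n - 1. *)
Definition BST (R : realType) (n : nat) : probability bintree R :=
  bst_law [seq i%:R : R | i <- iota 0 n].

Definition cvg_in_distribution d (T : measurableType d) (R : realType)
    (P : nat -> probability T R) (X : forall n, {RV (P n) >-> R})
    (mu : probability (measurableTypeR R) R) : Prop :=
  forall x : R, mu [set x] = 0%E ->
    cdf (X n) x @[n --> \oo] --> mu `]-oo, x]%classic.

(* [normal_prob 0 0] is a junk value in the library, whence the case split. *)
Definition centred_normal (R : realType) (sigma : R) :
    probability (measurableTypeR R) R :=
  if sigma == 0 then (\d_(0 : measurableTypeR R) : probability _ R)
  else (normal_prob 0 sigma : probability (measurableTypeR R) R).

Section rescaled_count.
Context (R : realType) (t : bintree) (b : R) (n : nat).

Definition rescaled_count (T : bintree) : R :=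
  ((N t (compress T))%:R - n%:R * b) / Num.sqrt n%:R.

Let measurable_rescaled_count : measurable_fun [set: bintree] rescaled_count.
Proof. by []. Qed.

HB.instance Definition _ := isMeasurableFun.Build _ _ _ _
  rescaled_count measurable_rescaled_count.

End rescaled_count.

(* b is the constant $\hat\beta_t$; variance zero is allowed for the limit. *)
Definition is_hat_beta (R : realType) (t : bintree) (b : R) : Prop :=
  exists sigma : R,
    cvg_in_distribution (P := BST R)
      (fun n => rescaled_count t b n : {RV (BST R n) >-> R})
      (centred_normal sigma).

Definition p (R : realType) (T : bintree) : R := fine (BST R (nodes T) [set T]).

Definition F (R : realType) (T : bintree) (x : R) : R := p R T * x ^+ nodes T.

(* The sum of the family (F T x), T in A; meaningful when it is [summable]. *)
Definition F_set (R : realType) (A : set bintree) (x : R) : R :=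
  fine (\esum_(T in A) (fun T' => (F T' x)%:E)^\+ T
        - \esum_(T in A) (fun T' => (F T' x)%:E)^\- T)%E.

Definition expansions (t : bintree) : set bintree := [set T | compress T = t].

Definition G (R : realType) (t : bintree) (x : R) : R := F_set (expansions t) x.

Definition oriented_integral (R : realType) (a b : R) (f : R -> R) : R :=
  if a <= b then \int[lebesgue_measure]_(y in `[a, b]) f y
  else - \int[lebesgue_measure]_(y in `[b, a]) f y.

(* Main.v *)
(* A tree compresses to t = Node tL tR iff its root either has one child, whose
   fringe tree compresses to t, or has subtrees compressing to tL and tR.
   With g_t(n) the probability that B_n compresses to t, and g_Empty(n) = [n=0]
   covering t = bullet, this gives (n+1) g_t(n+1) = 2 g_t(n) + h(n), where h is
   the Cauchy product of g_tL and g_tR; hence g_t(n) = O(K^n/n!), the generating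
   function is entire, and G_t' = 2 G_t + G_tL G_tR.
   The mean mu(n) of N_t satisfies (n+1) mu(n+1) = 2 sum_{i<=n} mu(i) + h(n), so
   mu(n)/n tends to sum_k 2 h(k)/((k+1)(k+2)(k+3)), which is the integral of
   (1-x)^2 G_tL G_tR.  Convergence in distribution of (N_t - n b)/sqrt n gives
   N_t/n -> b in probability, and since 0 <= N_t <= n also mu(n)/n -> b. *)

Require Import Defs.
From HB Require Import structures.
From mathcomp Require Import all_boot all_order all_algebra.
From mathcomp Require Import all_classical all_reals all_analysis.
From mathcomp Require Import ring lra zify.

Set Implicit Arguments.
Unset Strict Implicit.
Unset Printing Implicit Defensive.

Import Order.TTheory GRing.Theory Num.Theory.
Import numFieldNormedType.Exports.

Local Open Scope classical_set_scope.
Local Open Scope ring_scope.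

(** * Binary search trees of a given size *)

(** The product over the nodes v of T of 1/|T^v|: the hook-length form of the probability that a
    random binary search tree has shape T. *)
Fixpoint shape_prob (R : realType) (T : bintree) : R :=
  if T is Node l r then
    (nodes T)%:R^-1 * (shape_prob R l * shape_prob R r)
  else 1.

Lemma shape_prob_ge0 (R : realType) (T : bintree) : 0 <= shape_prob R T.
Proof.
by elim: T => [|l IHl r IHr]; rewrite ?ler01//= !mulr_ge0 ?invr_ge0.
Qed.

(** In a sorted list the pivot of index i leaves i smaller and [size s - i - 1] larger entries, so
    only the pivot of index [nodes l] can contribute. *)
Lemma bst_pmf_sorted (R : realType) (T : bintree) (s : seq R) :
  sorted <%R s -> bst_pmf s T = shape_prob R T * (size s == nodes T)%:R.
Proof.
elim: T s => [|l IHl r IHr] s ss; first by rewrite mul1r size_eq0.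
have filter_sorted a : sorted <%R [seq y <- s | a y].
  by apply: sorted_filter ss; exact: lt_trans.
have nth_lt i j : (i < size s)%N -> (j < size s)%N ->
    (s`_i < s`_j) = (i < j)%N.
  move=> si sj; case: (ltngtP i j) => [ij|ji|->]; last by rewrite ltxx.
    by rewrite (sorted_ltn_nth lt_trans).
  by apply/negbTE; rewrite -leNgt ltW// (sorted_ltn_nth lt_trans).
have count_lt i : (i < size s)%N -> size [seq y <- s | y < s`_i] = i.
  move=> si; rewrite size_filter -[in X in count _ X](mkseq_nth 0 s).
  rewrite /mkseq count_map.
  rewrite (eq_in_count (a2 := fun j => (0 <= j < i)%N)); last first.
    by move=> j; rewrite mem_iota /= add0n => sj; rewrite nth_lt.
  rewrite -size_filter -[RHS](size_iota 0); apply: perm_size; apply: uniq_perm.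
  - by rewrite filter_uniq// iota_uniq.
  - exact: iota_uniq.
  - by move=> j; rewrite mem_filter !mem_iota /=; lia.
have count_gt i : (i < size s)%N ->
    size [seq y <- s | s`_i < y] = (size s - i.+1)%N.
  move=> si; rewrite size_filter -[in X in count _ X](mkseq_nth 0 s).
  rewrite /mkseq count_map.
  rewrite (eq_in_count (a2 := fun j => (i < j)%N)); last first.
    by move=> j; rewrite mem_iota /= add0n => sj; rewrite nth_lt.
  rewrite -size_filter -[RHS](size_iota i.+1); apply: perm_size.
  apply: uniq_perm.
  - by rewrite filter_uniq// iota_uniq.
  - exact: iota_uniq.
  - by move=> j; rewrite mem_filter !mem_iota /=; lia.
rewrite /= (big_nth 0) big_mkord.
under eq_bigr => i _ do
  rewrite IHl// IHr// count_lt// count_gt// mulrACA -mulrA -natrM mulnb.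
rewrite -!mulr_sumr.
have [sn|sn] := eqVneq (size s) (nodes l + nodes r).+1.
  have ls : (nodes l < size s)%N by rewrite sn ltnS leq_addr.
  rewrite (bigD1 (Ordinal ls))//= big1 => [|i].
    rewrite eqxx addr0 sn (_ : (_ - _)%N == _) /=; last first.
      by rewrite subSS addKn.
    by rewrite !mulr1.
  by rewrite -val_eqE /= => /negbTE ->.
rewrite big1 ?mulr0// => i _; case: eqP => //= il; case: eqP => //= ir.
exfalso; move: (ltn_ord i) ir sn; rewrite il => /subnKC sE rE.
by rewrite -sE rE addSn eqxx.
Qed.

(** Bounding the height gives a structural recursion; a tree with at most h nodes has height at most
    h, so no tree of size n is lost in [trees n]. *)
Fixpoint trees_upto (h : nat) : seq bintree :=
  if h is h'.+1 then
    Defs.Empty :: [seq Node l r | l <- trees_upto h', r <- trees_upto h']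
  else [:: Defs.Empty].

Lemma trees_upto_uniq h : uniq (trees_upto h).
Proof.
elim: h => //= h IH; apply/andP; split; first by apply/allpairsP => -[[]] ? ? [].
by apply: allpairs_uniq => // -[a b] [c d] _ _ [-> ->].
Qed.

Lemma mem_trees_upto h T : (nodes T <= h)%N -> T \in trees_upto h.
Proof.
elim: T h => [|l IHl r IHr] [|h]//= lrh.
rewrite inE; apply/allpairsP; exists (l, r).
by split => //=; [apply: IHl|apply: IHr]; lia.
Qed.

Definition trees (n : nat) : seq bintree :=
  [seq T <- trees_upto n | nodes T == n].

Lemma trees_uniq n : uniq (trees n).
Proof. by rewrite filter_uniq ?trees_upto_uniq. Qed.

Lemma mem_trees n T : (T \in trees n) = (nodes T == n).
Proof.
by rewrite mem_filter; case: eqP => //= <-; exact: mem_trees_upto.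
Qed.

Lemma sum_trees_upto (V : nmodType) h n (f : bintree -> V) : (n <= h)%N ->
  \sum_(T <- trees_upto h | nodes T == n) f T = \sum_(T <- trees n) f T.
Proof.
move=> nh; rewrite -big_filter; apply: perm_big; apply: uniq_perm.
- by rewrite filter_uniq ?trees_upto_uniq.
- exact: trees_uniq.
- move=> T; rewrite mem_trees mem_filter; case: eqP => //= Tn.
  by rewrite mem_trees_upto// Tn.
Qed.

Lemma sum_trees0 (V : nmodType) (f : bintree -> V) :
  \sum_(T <- trees 0) f T = f Defs.Empty.
Proof. by rewrite /trees /= big_seq1. Qed.

Lemma sum_treesS (V : nmodType) n (f : bintree -> V) :
  \sum_(T <- trees n.+1) f T =
  \sum_(i < n.+1) \sum_(l <- trees i) \sum_(r <- trees (n - i)) f (Node l r).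
Proof.
rewrite big_filter /= big_cons /= big_mkcond big_allpairs_dep /=.
(* Discarding the left subtrees with more than n nodes makes [inord (nodes l)] below faithful. *)
rewrite (bigID (fun l => (nodes l < n.+1)%N)) /= [X in _ + X]big1 ?addr0; last first.
  move=> l ln; rewrite big1// => r _; case: ifP => //.
  by move: ln; lia.
rewrite (partition_big (fun l => inord (nodes l) : 'I_n.+1) predT)//=.
apply: eq_bigr => i _; rewrite -(@sum_trees_upto _ n) ?leq_ord//.
apply: eq_big => [l|l /andP[ln /eqP li]].
  apply/andP/eqP => [[ln /eqP <-]|li]; first by rewrite inordK.
  by rewrite li ltn_ord; split=> //; apply/eqP/val_inj; rewrite /= inordK.
rewrite -big_mkcond /= -(@sum_trees_upto _ n) ?leq_subr//.
have lE : nodes l = i by rewrite -li inordK.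
by apply: eq_bigl => r; rewrite lE; have := ltn_ord i; lia.
Qed.

(** The expectation of f under [BST R n], kept as a finite sum; [BST_mass] makes the link with the
    measure. *)
Definition Ebst (R : realType) (n : nat) (f : bintree -> R) : R :=
  \sum_(T <- trees n) shape_prob R T * f T.

Section Ebst_theory.
Variable R : realType.
Implicit Types (n : nat) (f a b : bintree -> R).

Lemma EbstD n a b : Ebst n (fun T => a T + b T) = Ebst n a + Ebst n b.
Proof. by rewrite -big_split; apply: eq_bigr => T _; rewrite mulrDr. Qed.

Lemma EbstZ n c a : Ebst n (fun T => c * a T) = c * Ebst n a.
Proof. by rewrite mulr_sumr; apply: eq_bigr => T _; rewrite mulrCA. Qed.

Lemma eq_Ebst n a b : (forall T, nodes T = n -> a T = b T) ->
  Ebst n a = Ebst n b.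
Proof.
by move=> ab; apply: eq_big_seq => T; rewrite mem_trees => /eqP/ab ->.
Qed.

Lemma le_Ebst n a b : (forall T, nodes T = n -> a T <= b T) ->
  Ebst n a <= Ebst n b.
Proof.
move=> ab; rewrite /Ebst big_seq [leRHS]big_seq; apply: ler_sum => T.
by rewrite mem_trees => /eqP/ab; apply: ler_wpM2l; exact: shape_prob_ge0.
Qed.

Lemma Ebst0 f : Ebst 0 f = f Defs.Empty.
Proof. by rewrite /Ebst sum_trees0 mul1r. Qed.

(** The size of the left subtree is uniform on 0, ..., n, and given this size the two subtrees are
    independent search trees. *)
Lemma EbstS n f :
  Ebst n.+1 f = n.+1%:R^-1 *
    \sum_(i < n.+1) Ebst i (fun l => Ebst (n - i) (fun r => f (Node l r))).
Proof.
rewrite /Ebst sum_treesS mulr_sumr; apply: eq_bigr => i _.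
rewrite mulr_sumr; apply: eq_big_seq => l; rewrite mem_trees => /eqP ln.
rewrite mulr_sumr mulr_sumr; apply: eq_big_seq => r.
by rewrite mem_trees => /eqP rn /=; rewrite ln rn subnKC ?leq_ord// !mulrA.
Qed.

Lemma Ebst_prod i j a b :
  Ebst i (fun l => Ebst j (fun r => a l * b r)) = Ebst i a * Ebst j b.
Proof.
rewrite [RHS]mulrC -EbstZ; apply: eq_Ebst => T _.
by rewrite EbstZ mulrC.
Qed.

Lemma Ebst1 n : Ebst n (fun=> 1 : R) = 1.
Proof.
have [m] := ubnP n; elim: m n => // m IH [|n] nm; first by rewrite Ebst0.
rewrite EbstS (eq_bigr (fun=> 1)) => [|i _].
  by rewrite sumr_const card_ord mulVf// pnatr_eq0.
rewrite -[RHS](IH i) ?(leq_trans (ltn_ord i))//; apply: eq_Ebst => T _.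
by rewrite IH//; apply: leq_ltn_trans (leq_subr _ _) _; exact: nm.
Qed.

Lemma Ebst_cst n (c : R) : Ebst n (fun=> c) = c.
Proof. by rewrite -[c in LHS]mulr1 EbstZ Ebst1 mulr1. Qed.

End Ebst_theory.

(** * Compression and fringe counts *)

Lemma compress_eq_empty T : (compress T == Defs.Empty) = (T == Defs.Empty).
Proof.
by elim: T => //= -[|a b] IHl [|c d] IHr.
Qed.

Lemma compress_Node l r : l != Defs.Empty -> r != Defs.Empty ->
  compress (Node l r) = Node (compress l) (compress r).
Proof. by case: l => // a b; case: r. Qed.

(* The empty tree is allowed, so that the two cases of the recursion (one node,
   two nonempty subtrees) become one. *)
Definition empty_or_full (t : bintree) : bool := (t == Defs.Empty) || is_full t.

(** The last clause excludes nodes with one child; it is the form in which fullness enters the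
    recursions. *)
Lemma empty_or_full_Node l r : empty_or_full (Node l r) ->
  [/\ empty_or_full l, empty_or_full r &
      (l == Defs.Empty) = (r == Defs.Empty)].
Proof.
case: l => [|a b]; case: r => [|c d]; rewrite /empty_or_full //=.
- by rewrite andbF.
- by move=> /andP[].
Qed.

Lemma Node_eq a b c d : (Node a b == Node c d) = (a == c) && (b == d).
Proof. by apply/eqP/andP => [[-> ->]//|[/eqP -> /eqP ->]]. Qed.

(** If exactly one of l, r is empty, the last term vanishes: [compress] preserves emptiness, so
    exactly one of tL, tR would be empty. If both are empty only the last term can survive, and if
    neither is, the first two vanish. *)
Lemma compress_Node_eq (R : nzRingType) tL tR l r :
  (tL == Defs.Empty) = (tR == Defs.Empty) ->
  (compress (Node l r) == Node tL tR)%:R =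
    (l == Defs.Empty)%:R * (compress r == Node tL tR)%:R
    + (compress l == Node tL tR)%:R * (r == Defs.Empty)%:R
    + (compress l == tL)%:R * (compress r == tR)%:R :> R.
Proof.
move=> tLR; have [->|l0] := eqVneq l Defs.Empty.
  have [->|r0] := eqVneq r Defs.Empty.
    rewrite /= Node_eq (eq_sym _ tL) (eq_sym _ tR).
    by rewrite !mulr0 mul0r !add0r -natrM mulnb.
  rewrite mulr0 mul1r addr0 -natrM mulnb.
  have -> : compress (Node Defs.Empty r) = compress r by case: r r0.
  rewrite [(_ == tL) && _](_ : _ = false) ?addr0//=.
  apply/negbTE; apply: contraNN r0 => /andP[tL0 /eqP rR].
  by rewrite -compress_eq_empty rR -tLR eq_sym.
have [->|r0] := eqVneq r Defs.Empty.
  rewrite mulr1 mul0r add0r -natrM mulnb.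
  have -> : compress (Node l Defs.Empty) = compress l by case: l l0.
  rewrite [(_ == tL) && _](_ : _ = false) ?addr0//=.
  apply/negbTE; apply: contraNN l0 => /andP[/eqP lL tR0].
  by rewrite -compress_eq_empty lL tLR eq_sym.
by rewrite compress_Node// Node_eq mul0r mulr0 !add0r -natrM mulnb.
Qed.

Lemma N_empty t : N t Defs.Empty = 0%N. Proof. by []. Qed.

Lemma N_Node t l r : N t (Node l r) = ((Node l r == t) + N t l + N t r)%N.
Proof. by rewrite /N /= count_cat addnA. Qed.

(** The product is the contribution of the root. It vanishes when the root has one child and is
    deleted, for the same reason as in [compress_Node_eq]. *)
Lemma N_compress_Node tL tR l r : (tL == Defs.Empty) = (tR == Defs.Empty) ->
  N (Node tL tR) (compress (Node l r)) =
  (N (Node tL tR) (compress l) + N (Node tL tR) (compress r)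
   + (compress l == tL) * (compress r == tR))%N.
Proof.
move=> tLR; have [->|l0] := eqVneq l Defs.Empty.
  have [->|r0] := eqVneq r Defs.Empty.
    rewrite N_Node !N_empty Node_eq (eq_sym _ tL) (eq_sym _ tR).
    by rewrite mulnb !addn0.
  have -> : compress (Node Defs.Empty r) = compress r by case: r r0.
  rewrite mulnb [(_ == tL) && _](_ : _ = false) ?addn0//=.
  apply/negbTE; apply: contraNN r0 => /andP[tL0 /eqP rR].
  by rewrite -compress_eq_empty rR -tLR eq_sym.
have [->|r0] := eqVneq r Defs.Empty.
  have -> : compress (Node l Defs.Empty) = compress l by case: l l0.
  rewrite mulnb [(_ == tL) && _](_ : _ = false) ?addn0//=.
  apply/negbTE; apply: contraNN l0 => /andP[/eqP lL tR0].
  by rewrite -compress_eq_empty lL tLR eq_sym.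
by rewrite compress_Node// N_Node Node_eq mulnb -addnA addnC.
Qed.

(** This bound keeps N/n in [0, 1], which allows passing from the limit law to the means. *)
Lemma N_compress_le t T : (N t (compress T) <= nodes T)%N.
Proof.
suff H S : (N t S <= nodes S)%N.
  apply: leq_trans (H _) _; elim: T => // l IHl r IHr.
  have [->|l0] := eqVneq l Defs.Empty.
    have [->|r0] := eqVneq r Defs.Empty => //.
    have -> : compress (Node Defs.Empty r) = compress r by case: r r0 {IHr}.
    exact: leqW.
  have [->|r0] := eqVneq r Defs.Empty.
    have -> : compress (Node l Defs.Empty) = compress l by case: l l0 {IHl}.
    by rewrite /= addn0; exact: leqW.
  by rewrite compress_Node//= ltnS leq_add.
elim: S => // l IHl r IHr; rewrite N_Node /= -addnA -add1n.
by rewrite leq_add ?leq_b1// leq_add.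
Qed.

(** * Recursions for the compression probabilities and the mean counts *)

Section compress_prob.
Variable R : realType.

Definition compress_prob (t : bintree) (n : nat) : R :=
  Ebst n (fun T => (compress T == t)%:R).

Lemma compress_prob_ge0 t n : 0 <= compress_prob t n.
Proof. by rewrite -(Ebst_cst n (0 : R)); apply: le_Ebst => T _; exact: ler0n. Qed.

Lemma compress_prob_le1 t n : compress_prob t n <= 1.
Proof.
by rewrite -(Ebst_cst n (1 : R)); apply: le_Ebst => T _; rewrite lern1 leq_b1.
Qed.

Lemma compress_prob_empty n : compress_prob Defs.Empty n = (n == 0%N)%:R.
Proof.
rewrite -(Ebst_cst n (n == 0%N)%:R); apply: eq_Ebst => T.
by rewrite compress_eq_empty => <-; case: T.
Qed.

Lemma compress_prob0 l r : compress_prob (Node l r) 0 = 0.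
Proof. by rewrite /compress_prob Ebst0. Qed.

Definition cauchy_prod (c d : nat -> R) (n : nat) : R :=
  \sum_(i < n.+1) c i * d (n - i)%N.

Lemma compress_probS tL tR n : empty_or_full (Node tL tR) ->
  n.+1%:R * compress_prob (Node tL tR) n.+1 =
  2 * compress_prob (Node tL tR) n
  + cauchy_prod (compress_prob tL) (compress_prob tR) n.
Proof.
move=> /empty_or_full_Node[_ _ tLR].
rewrite {1}/compress_prob EbstS mulVKf ?pnatr_eq0//.
under eq_bigr => i _.
  under eq_Ebst => l _.
    under eq_Ebst => r _ do rewrite compress_Node_eq//.
    rewrite 2!EbstD; over.
  rewrite 2!EbstD 3!Ebst_prod; over.
rewrite 2!big_split /= -/(cauchy_prod _ _ _); congr (_ + _).
have emptyE k : Ebst k (fun T => (T == Defs.Empty)%:R) = (k == 0%N)%:R :> R.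
  by rewrite -compress_prob_empty; apply: eq_Ebst => T _; rewrite compress_eq_empty.
(* An empty left subtree leaves only i = 0 in the first sum, an empty right one only i = n in the
   second. *)
rewrite big_ord_recl /= big1 => [|i _]; last by rewrite emptyE mul0r.
rewrite big_ord_recr /= big1 => [|i _]; last first.
  by rewrite emptyE subn_eq0 leqNgt ltn_ord mulr0.
rewrite !emptyE subnn subn0 eqxx mul1r mulr1 addr0 add0r.
by rewrite /compress_prob; ring.
Qed.

Definition mean_count (t : bintree) (n : nat) : R :=
  Ebst n (fun T => (N t (compress T))%:R).

Lemma mean_count0 t : mean_count t 0 = 0.
Proof. by rewrite /mean_count Ebst0. Qed.

Lemma mean_countS tL tR n : empty_or_full (Node tL tR) ->
  n.+1%:R * mean_count (Node tL tR) n.+1 =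
  2 * \sum_(i < n.+1) mean_count (Node tL tR) i
  + cauchy_prod (compress_prob tL) (compress_prob tR) n.
Proof.
move=> /empty_or_full_Node[_ _ tLR].
rewrite {1}/mean_count EbstS mulVKf ?pnatr_eq0//.
under eq_bigr => i _.
  under eq_Ebst => l _.
    under eq_Ebst => r _ do rewrite N_compress_Node// !natrD natrM.
    rewrite 2!EbstD Ebst_cst; over.
  rewrite 2!EbstD Ebst_cst Ebst_prod; over.
rewrite 2!big_split /=; congr (_ + _).
rewrite mulr_natl mulr2n; congr (_ + _).
(* The right subtree has size n - i, so reversing the order of summation gives the sum for the left
   one. *)
rewrite (reindex_inj rev_ord_inj) /=; apply: eq_bigr => i _.
by rewrite subSS subKn ?leq_ord.
Qed.

(** Subtracting consecutive instances of the recursion gives (n+2) m(n+2) = (n+3) m(n+1) + h(n+1) -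
    h(n). Division by (n+2)(n+3) makes it telescope, and summation by parts yields 1/((k+1)(k+2)) -
    1/((k+2)(k+3)) = 2/((k+1)(k+2)(k+3)) as the weight of h(k). *)
Lemma mean_countE tL tR n : empty_or_full (Node tL tR) ->
  let h := cauchy_prod (compress_prob tL) (compress_prob tR) in
  mean_count (Node tL tR) n.+1 / n.+2%:R =
  h n / (n.+1%:R * n.+2%:R)
  + \sum_(0 <= k < n) 2 * (h k / (k.+1%:R * k.+2%:R * k.+3%:R)).
Proof.
move=> tf h; elim: n => [|n IH].
  have := mean_countS 0 tf; rewrite big_ord1 mean_count0 big_geq// -/h.
  by rewrite mul1r mulr0 add0r addr0 => ->; rewrite mul1r.
have := mean_countS n.+1 tf; rewrite big_ord_recr /= mulrDr -/h.
have := mean_countS n tf; rewrite -/h => E.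
have -> : 2 * (\sum_(i < n.+1) mean_count (Node tL tR) i) =
    n.+1%:R * mean_count (Node tL tR) n.+1 - h n by rewrite E addrK.
rewrite big_nat_recr //=.
move: IH; set s := \sum_(0 <= k < n) _ => IH E2.
have {}IH : mean_count (Node tL tR) n.+1 =
    n.+2%:R * (h n / (n.+1%:R * n.+2%:R) + s).
  by rewrite -IH mulrC divfK// pnatr_eq0.
have {}E2 : mean_count (Node tL tR) n.+2 =
  (n.+3%:R * mean_count (Node tL tR) n.+1 + h n.+1 - h n) / n.+2%:R.
  apply: (mulfI (x := n.+2%:R)); first by rewrite pnatr_eq0.
  rewrite [RHS]mulrC divfK ?pnatr_eq0// E2.
  by rewrite -(addn2 n.+1) natrD; ring.
rewrite E2 IH -(addn3 n) -(addn2 n) -(addn1 n) !natrD.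
field.
have n0 : 0 <= n%:R :> R by exact: ler0n.
by rewrite !gt_eqF //; lra.
Qed.

End compress_prob.

(** * Entire power series *)

Section exp_bounded.
Variable R : realType.
Implicit Types (c d g h : nat -> R) (x y : R).

(* Equivalently, the power series with coefficients [c] is entire of
   exponential type. *)
Definition exp_bounded c :=
  exists C K : R, 0 <= K /\ forall n, `|c n| <= C * (K ^+ n / n`!%:R).

Definition psum c x : R := limn (pseries c x).

Lemma exp_bounded_ge0 c C K :
  (forall n, `|c n| <= C * (K ^+ n / n`!%:R)) -> 0 <= C.
Proof. by move=> /(_ 0%N); rewrite divr1 mulr1; exact: le_trans. Qed.

Lemma exp_bounded_norm_cvg c x : exp_bounded c ->
  cvgn (pseries (fun n => `|c n|) `|x|).
Proof.
move=> [C [K [K0 cK]]].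
apply: (@series_le_cvg _ _ (C *: exp_coeff (K * `|x|))) => [n|n|n|].
- by rewrite mulr_ge0 ?exprn_ge0.
- rewrite mulr_ge0 ?(exp_bounded_ge0 cK)//.
  by rewrite exp_coeff_ge0// mulr_ge0.
- rewrite -[leRHS]/(C * ((K * `|x|) ^+ n / n`!%:R)) exprMn mulrAC mulrA.
  by rewrite ler_wpM2r ?exprn_ge0.
- by apply: is_cvg_seriesZ; exact: is_cvg_series_exp_coeff.
Qed.

Lemma exp_bounded_is_cvg c x : exp_bounded c -> cvgn (pseries c x).
Proof.
move=> /(@exp_bounded_norm_cvg _ x) cx; apply: normed_cvg.
rewrite (_ : [normed _] = pseries (fun n => `|c n|) `|x|)//.
by apply/funext => n; apply: eq_bigr => i _ /=; rewrite normrM normrX.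
Qed.

Lemma exp_bounded_cvg c x : exp_bounded c -> pseries c x @ \oo --> psum c x.
Proof. by move=> /exp_bounded_is_cvg; apply. Qed.

Lemma exp_bounded_diffs c : exp_bounded c -> exp_bounded (pseries_diffs c).
Proof.
move=> [C [K [K0 cK]]]; exists (C * K), K; split=> // n.
rewrite /pseries_diffs normrM normr_nat.
apply: le_trans (ler_wpM2l _ (cK n.+1)) _ => //.
rewrite factS natrM exprS le_eqVlt; apply/orP; left; apply/eqP.
by field; rewrite nat1r !pnatr_eq0 -lt0n fact_gt0.
Qed.

Lemma is_derive_psum c x : exp_bounded c ->
  is_derive x 1 (psum c) (psum (pseries_diffs c) x).
Proof.
(* Any point beyond [|x|] would do, since all three series converge everywhere. *)
move=> cb; apply: (@pseries_snd_diffs _ _ (`|x| + 1)).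
- exact: exp_bounded_is_cvg.
- exact/exp_bounded_is_cvg/exp_bounded_diffs.
- exact/exp_bounded_is_cvg/exp_bounded_diffs/exp_bounded_diffs.
- by rewrite [ltRHS]ger0_norm// ltrDl.
Qed.

(** The coefficients of the antiderivative that vanishes at 0. *)
Definition antidiffs c n : R := if n is m.+1 then c m / m.+1%:R else 0.

Lemma antidiffsK c : pseries_diffs (antidiffs c) = c.
Proof.
by apply/funext => n; rewrite /pseries_diffs /= mulrC divfK// pnatr_eq0.
Qed.

Lemma exp_bounded_antidiffs c : exp_bounded c -> exp_bounded (antidiffs c).
Proof.
move=> [C [K [K0 cK]]]; have C0 := exp_bounded_ge0 cK.
(* The exponent rises by one, and K^n <= K^(n+1) may fail for K < 1, whereas K^n <= (K+1)^(n+1)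
   always holds. *)
exists C, (K + 1); split=> [|[|n]]; first by rewrite addr_ge0.
  by rewrite normr0 divr1 mulr1.
rewrite normrM normfV normr_nat factS natrM invfM.
rewrite [leRHS](_ : _ = C * ((K + 1) ^+ n.+1 / n`!%:R) / n.+1%:R); last ring.
rewrite ler_wpM2r//; apply: le_trans (cK n) _.
rewrite ler_wpM2l// ler_wpM2r// exprSr -[leLHS]mulr1.
by rewrite ler_pM ?exprn_ge0// ?lerXn2r ?nnegrE ?addr_ge0 ?lerDl ?lerDr.
Qed.

(** By the binomial theorem. The absolute values stand inside the sum so that the bound also covers
    products of truncated series. *)
Lemma cauchy_prod_bound c d : exp_bounded c -> exp_bounded d ->
  exists C K : R, 0 <= K /\ forall n,
    \sum_(i < n.+1) `|c i| * `|d (n - i)%N| <= C * (K ^+ n / n`!%:R).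
Proof.
move=> [C [K [K0 cK]]] [D [L [L0 dL]]].
exists (C * D), (L + K); split=> [|n]; first exact: addr_ge0.
rewrite exprDn mulr_suml mulr_sumr; apply: ler_sum => i _.
apply: le_trans (ler_pM _ _ (cK i) (dL _)) _ => //.
have [ni nj] : n`!%:R != 0 :> R /\ (n - i)`!%:R != 0 :> R.
  by rewrite !pnatr_eq0 -!lt0n !fact_gt0.
have i0 : i`!%:R != 0 :> R by rewrite pnatr_eq0 -lt0n fact_gt0.
have bE : 'C(n, i)%:R = n`!%:R / (i`!%:R * (n - i)`!%:R) :> R.
  rewrite -(bin_fact (leq_ord i)) !natrM mulfK// mulf_neq0//.
rewrite -[X in _ <= _ * (X / _)]mulr_natr bE le_eqVlt; apply/orP; left; apply/eqP.
by field; rewrite ni nj i0.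
Qed.

Lemma exp_bounded_cauchy_prod c d : exp_bounded c -> exp_bounded d ->
  exp_bounded (cauchy_prod c d).
Proof.
move=> cb db; have [C [K [K0 H]]] := cauchy_prod_bound cb db.
exists C, K; split=> // n; apply: le_trans (H n).
by apply: le_trans (ler_norm_sum _ _ _) _; under eq_bigr do rewrite normrM.
Qed.

Lemma psum_cauchy_prod c d x : exp_bounded c -> exp_bounded d ->
  psum (cauchy_prod c d) x = psum c x * psum d x.
Proof.
move=> cb db; have [C [K [K0 CK]]] := cauchy_prod_bound cb db.
apply/cvg_lim => //.
pose S := series (exp_coeff (K * `|x|)).
have cvS : cvgn S by exact: is_cvg_series_exp_coeff.
(* The block of the exponential series from n to 2n, which will bound the error, tends to 0. *)
have cv2 : C * (S (n + n)%N - S n) @[n --> \oo] --> C * (limn S - limn S).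
  apply: cvgMr; apply: cvgB => //.
  apply: (@cvg_comp _ _ _ (fun n => (n + n)%N) S _ \oo) => //.
  by apply/cvgnyPge => A; near do apply: leq_trans (leq_addr _ _); exact: nbhs_infty_ge.
rewrite subrr mulr0 in cv2.
have cvp : pseries c x n * pseries d x n @[n --> \oo] --> psum c x * psum d x.
  by apply: cvgM; exact: exp_bounded_cvg.
suff : (pseries c x n * pseries d x n
        - (pseries c x n * pseries d x n - pseries (cauchy_prod c d) x n))
    @[n --> \oo] --> psum c x * psum d x - 0.
  by rewrite subr0; under eq_fun do rewrite subKr.
apply: cvgB => //; apply/norm_cvg0P.
(* The product of the truncations, as polynomials, differs from the truncated
   Cauchy product by terms of degree in [n, 2n), bounded by an exponential
   tail. *)
apply: squeeze_cvgr (cvg_cst 0) cv2.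
near=> n; rewrite normr_ge0 /=.
pose P := \poly_(i < n) c i; pose Q := \poly_(i < n) d i.
have pE (e : nat -> R) : pseries e x n = (\poly_(i < n) e i).[x].
  by rewrite horner_poly /pseries /series /= big_mkord.
rewrite (pE c) (pE d) -hornerM.
have sPQ : (size (P * Q)%R <= n + n)%N.
  apply: leq_trans (size_polyMleq _ _) _; rewrite -/P -/Q.
  by apply: leq_trans (leq_pred _) _; rewrite leq_add ?size_poly.
rewrite (horner_coef_wide _ sPQ) -(big_mkord predT (fun i => (P * Q)`_i * x ^+ i)).
rewrite (big_cat_nat _ (n := n)) ?leq_addr//=.
rewrite /pseries /series /=.
have -> : \sum_(0 <= i < n) (P * Q)`_i * x ^+ i =
          \sum_(0 <= i < n) cauchy_prod c d i * x ^+ i.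
  rewrite !big_mkord; apply: eq_bigr => i _; rewrite coefM; congr (_ * _).
  apply: eq_bigr => j _; rewrite !coef_poly.
  by rewrite !(leq_ltn_trans _ (ltn_ord i)) ?leq_ord// leq_subr.
rewrite addrAC subrr add0r /S /series /= sub_series_geq ?leq_addr//.
rewrite mulr_sumr; apply: le_trans (ler_norm_sum _ _ _) _; apply: ler_sum => k _.
rewrite normrM normrX /exp_coeff /= exprMn mulrAC mulrA.
rewrite ler_wpM2r ?exprn_ge0//; apply: le_trans (CK k).
(* Truncation only replaces coefficients by 0, so each term is at most its counterpart in the full
   convolution. *)
rewrite coefM; apply: le_trans (ler_norm_sum _ _ _) _; apply: ler_sum => j _.
rewrite normrM !coef_poly.
by case: ifP; case: ifP; rewrite ?normr0 ?mul0r ?mulr0 ?mulr_ge0.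
Unshelve. all: by end_near. Qed.

Lemma exp_bounded_rec g h : exp_bounded h ->
  (forall n, n.+1%:R * g n.+1 = 2 * g n + h n) -> exp_bounded g.
Proof.
move=> [C [K [K0 hK]]] gS; have C0 := exp_bounded_ge0 hK.
(* The term [|g 0|] settles n = 0; the 3 absorbs, at each step, the factor 2 of g and the factor 1
   of h. *)
exists (C + `|g 0%N|), (K + 3); split=> [|n]; first by rewrite addr_ge0.
elim: n => [|n IH]; first by rewrite divr1 mulr1 lerDr.
set D := C + _ in IH *.
have D0 : 0 <= D by rewrite addr_ge0.
have -> : g n.+1 = (2 * g n + h n) / n.+1%:R.
  by rewrite -gS mulrC mulKf// pnatr_eq0.
rewrite normrM normfV normr_nat factS natrM invfM.
rewrite [leRHS](_ : _ = D * (K + 3) * ((K + 3) ^+ n / n`!%:R) / n.+1%:R); last first.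
  by rewrite exprS; ring.
rewrite ler_wpM2r//; apply: le_trans (ler_normD _ _) _.
rewrite normrM (@ger0_norm _ 2)//.
set X := (K + 3) ^+ n / _ in IH *.
have hX : `|h n| <= D * X.
  apply: le_trans (hK n) _; apply: ler_pM => //.
  - by rewrite mulr_ge0 ?exprn_ge0.
  - by rewrite lerDl.
  - by rewrite ler_wpM2r// lerXn2r ?nnegrE ?addr_ge0// lerDl.
have X0 : 0 <= X by rewrite mulr_ge0 ?exprn_ge0 ?addr_ge0.
have DKX : 0 <= D * K * X by exact: mulr_ge0 (mulr_ge0 D0 K0) X0.
by rewrite mulrDr mulrDl; lra.
Qed.

Lemma exp_boundedZ (k : R) c : exp_bounded c -> exp_bounded (fun n => k * c n).
Proof.
move=> [C [K [K0 cK]]]; exists (`|k| * C), K; split=> // n.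
by rewrite normrM -mulrA ler_wpM2l.
Qed.

Lemma psumD c d x : exp_bounded c -> exp_bounded d ->
  psum (fun n => c n + d n) x = psum c x + psum d x.
Proof.
move=> /(@exp_bounded_cvg _ x) cc /(@exp_bounded_cvg _ x) dc.
apply/cvg_lim => //.
suff -> : pseries (fun n => c n + d n) x = pseries c x + pseries d x.
  exact: cvgD.
apply/funext => n; rewrite /pseries fctE /series /= -big_split.
by apply: eq_bigr => i _; rewrite mulrDl.
Qed.

Lemma psumZ (k : R) c x : exp_bounded c ->
  psum (fun n => k * c n) x = k * psum c x.
Proof.
move=> /(@exp_bounded_cvg _ x) cc.
apply/cvg_lim => //.
suff -> : pseries (fun n => k * c n) x = k \*o pseries c x by exact: cvgMr.
apply/funext => n; rewrite /pseries /series /= mulr_sumr.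
by apply: eq_bigr => i _; rewrite mulrA.
Qed.

Lemma is_derive_psum_rec g h x : exp_bounded h ->
  (forall n, n.+1%:R * g n.+1 = 2 * g n + h n) ->
  is_derive x 1 (psum g) (2 * psum g x + psum h x).
Proof.
move=> hb gS; have gb := exp_bounded_rec hb gS.
apply: is_derive_eq; first exact: is_derive_psum.
rewrite (_ : pseries_diffs g = (fun n => 2 * g n + h n)); last exact/funext.
by rewrite psumD ?psumZ//; exact: exp_boundedZ.
Qed.

Lemma psum0 c : psum c 0 = c 0%N.
Proof.
(* The partial sum with no terms is 0, so the sequence is constant only after one shift. *)
apply/cvg_lim => //; rewrite -cvg_shiftS /=.
apply: cvg_near_cst; near=> n.
rewrite /pseries /series /= big_nat_recl//= mulr1 big1 ?addr0// => i _.
by rewrite expr0n mulr0.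
Unshelve. all: by end_near. Qed.

End exp_bounded.

(** * Integral representations of power series *)

Section integrals.
Variable R : realType.
Implicit Types (u f : R -> R) (g h : nat -> R).

Lemma oriented_integral_FTC u f (a b : R) :
  (forall x : R, is_derive x (1 : R) u (f x)) -> continuous f ->
  oriented_integral a b f = u b - u a.
Proof.
move=> uf cf.
have du (x : R) : derivable u x 1 by case: (uf x).
have cu : continuous u.
  by move=> x; apply/differentiable_continuous/derivable1_diffP.
have FTC (c d : R) : c < d ->
    \int[lebesgue_measure]_(x in `[c, d]) f x = u d - u c.
  move=> cd; rewrite /Rintegral (continuous_FTC2 (F := u) cd) => [//| | |x _].
  - exact: continuous_subspaceT.
  - split=> [x _//| |]; first exact/cvg_at_right_filter/cu.
    exact/cvg_at_left_filter/cu.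
  - by rewrite derive1E derive_val.
rewrite /oriented_integral; case: (ltgtP a b) => [ab|ba|->].
- exact: FTC.
- by rewrite FTC// opprB.
- by rewrite set_itv1 Rintegral_set1 subrr.
Qed.

Lemma continuous_psum h : exp_bounded h -> continuous (psum h).
Proof.
move=> hb x; apply/differentiable_continuous/derivable1_diffP.
by case: (is_derive_psum x hb).
Qed.

(** Integrating factor: y |-> [psum g y * expR (2 * (x - y))] has the integrand as derivative,
    equals [psum g x] at y = x, and vanishes at y = 0. *)
Lemma psum_rec_integral g h x : exp_bounded h -> g 0%N = 0 ->
  (forall n, n.+1%:R * g n.+1 = 2 * g n + h n) ->
  psum g x = oriented_integral 0 x (fun y => psum h y * expR (2 * (x - y))).
Proof.
move=> hb g0 gS.
have du (y : R) : is_derive y (1 : R) (fun y => psum g y * expR (2 * (x - y)))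
    (psum h y * expR (2 * (x - y))).
  have dg := is_derive_psum_rec y hb gS.
  have dl : is_derive y (1 : R) (fun y => 2 * (x - y)) (- 2).
    by apply: is_derive_eq; rewrite /GRing.scale /=; ring.
  have de : is_derive y (1 : R) (fun y => expR (2 * (x - y)))
      (expR (2 * (x - y)) * - 2).
    exact: (@is_derive1_comp _ expR (fun y => 2 * (x - y)) y _ _ _ dl).
  by apply: is_derive_eq; rewrite /GRing.scale /=; ring.
have cf : continuous (fun y : R => psum h y * expR (2 * (x - y))).
  move=> y; apply: cvgM; first exact: continuous_psum.
  apply: (@continuous_comp _ _ _ (fun y => 2 * (x - y)) expR).
    by apply: cvgMr; apply: cvgB => //; exact: cvg_cst.
  exact: continuous_expR.
rewrite (oriented_integral_FTC 0 x du cf).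
by rewrite psum0 g0 mul0r subrr mulr0 expR0 mulr1 subr0.
Qed.

(** Cauchy's formula for repeated integration at 1: half the integral is the third iterated
    antiderivative of [psum h], and three integrations divide the coefficient h(k) by
    (k+1)(k+2)(k+3). *)
Lemma integral_sqr_psum h : exp_bounded h ->
  \sum_(0 <= k < n) 2 * (h k / (k.+1%:R * k.+2%:R * k.+3%:R)) @[n --> \oo] -->
  \int[lebesgue_measure]_(x in `[0, 1]) ((1 - x) ^+ 2 * psum h x).
Proof.
move=> hb.
pose A1 := antidiffs h; pose A2 := antidiffs A1; pose A3 := antidiffs A2.
have b1 : exp_bounded A1 by exact: exp_bounded_antidiffs.
have b2 : exp_bounded A2 by exact: exp_bounded_antidiffs.
have b3 : exp_bounded A3 by exact: exp_bounded_antidiffs.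
(* An antiderivative, found by integrating by parts twice. *)
pose u x := (1 - x) ^+ 2 * psum A1 x + 2 * (1 - x) * psum A2 x + 2 * psum A3 x.
have du (x : R) : is_derive x (1 : R) u ((1 - x) ^+ 2 * psum h x).
  have d1 := is_derive_psum x b1; have d2 := is_derive_psum x b2.
  have d3 := is_derive_psum x b3.
  rewrite !antidiffsK in d1 d2 d3.
  by apply: is_derive_eq; rewrite /GRing.scale /=; ring.
have cf : continuous (fun x : R => (1 - x) ^+ 2 * psum h x).
  move=> x; apply: cvgM; last exact: continuous_psum.
  have c1 : 1 - y @[y --> x] --> 1 - x by apply: cvgB => //; exact: cvg_cst.
  exact: (cvgM c1 c1).
have := oriented_integral_FTC 0 1 du cf.
rewrite /oriented_integral ler01 => ->.
rewrite /u !psum0 subrr expr0n /= !mulr0 !mul0r !add0r subr0.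
have A1v := exp_bounded_cvg (x := 1) b3.
have : 2 * pseries A3 1 n @[n --> \oo] --> 2 * psum A3 1 by exact: cvgMr.
(* The first three coefficients of [A3] are 0. *)
rewrite -(cvg_shiftn 3); apply: cvg_trans; apply: near_eq_cvg; near=> n.
rewrite /pseries /series /= addn3 3?big_nat_recl// /= !mul0r !add0r.
rewrite mulr_sumr; apply: eq_bigr => k _.
by rewrite expr1n mulr1 -!mulrA -!invfM [X in _ / X]mulrC; congr (_ * (_ / _)); ring.
Unshelve. all: by end_near. Qed.

End integrals.

(** * The generating functions *)

Section generating_functions.
Variable R : realType.
Implicit Types (A : set bintree) (t T : bintree) (x : R).

Definition shape_mass A n : R := \sum_(T <- trees n | T \in A) shape_prob R T.

Lemma esum_trees A (f : bintree -> \bar R) n : (forall T, 0 <= f T)%E ->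
  (\esum_(T in A `&` [set` trees n]) f T = \sum_(T <- trees n | T \in A) f T)%E.
Proof.
move=> f0.
have -> : A `&` [set` trees n] = [set` [seq T <- trees n | T \in A]].
  apply/seteqP; split=> [T [AT /= Tn]|T].
    by rewrite mem_filter Tn andbT; exact: mem_set.
  by rewrite /= mem_filter => /andP[/set_mem].
rewrite (esum_fset (finite_seq _))//.
by rewrite -fsbig_seq ?big_filter// filter_uniq ?trees_uniq.
Qed.

(** The keys 0, ..., n - 1 are sorted, so [bst_pmf_sorted] applies, and trees whose size is not n
    carry no mass. *)
Lemma BST_mass n A : BST R n A = (shape_mass A n)%:E.
Proof.
have ss : sorted <%R [seq i%:R : R | i <- iota 0 n].
  rewrite sorted_map; apply: sub_sorted (iota_ltn_sorted 0 n) => i j.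
  by rewrite /= ltr_nat.
pose f T : \bar R := (bst_pmf [seq i%:R : R | i <- iota 0 n] T)%:E.
have f0 T : (0 <= f T)%E by rewrite lee_fin bst_pmf_ge0.
have fE T : f T = (shape_prob R T * (T \in trees n)%:R)%:E.
  by rewrite /f bst_pmf_sorted// size_map size_iota mem_trees eq_sym.
transitivity (\esum_(T in A) f T)%E; first by [].
rewrite (esumID [set` trees n])// esum_trees// [X in (_ + X)%E]esum1 ?adde0.
  rewrite /shape_mass -sumEFin big_seq_cond [RHS]big_seq_cond.
  by apply: eq_bigr => T /andP[Tn _]; rewrite fE Tn mulr1.
by move=> T [_ /= /negP/negbTE Tn]; rewrite fE Tn mulr0.
Qed.

Lemma p_shape_prob T : p R T = shape_prob R T.
Proof.
rewrite /p BST_mass /= /shape_mass -big_filter.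
rewrite (_ : [seq _ <- _ | _] = [:: T]) ?big_seq1//.
rewrite (eq_filter (a2 := pred1 T)) ?filter_pred1_uniq ?trees_uniq ?mem_trees//.
by move=> S; apply/idP/eqP => [/set_mem//|->]; exact: mem_set.
Qed.

Lemma nneseries_EFin (v : nat -> R) : cvgn (series v) ->
  (\sum_(n <oo) (v n)%:E = (limn (series v))%:E)%E.
Proof.
by move=> cv; rewrite -EFin_lim//; congr (limn _); apply/funext => n; rewrite sumEFin.
Qed.

(** Nonnegative terms may be regrouped along the partition of A by number of nodes, which turns a
    sum over trees into a series over n. *)
Lemma esum_by_nodes A (u : nat -> R) : (forall n, 0 <= u n) ->
  cvgn (series (fun n => shape_mass A n * u n)) ->
  (\esum_(T in A) (p R T * u (nodes T))%:E =
   (limn (series (fun n => shape_mass A n * u n)))%:E)%E.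
Proof.
move=> u0 cu; rewrite -nneseries_EFin//.
have pu0 T : (0 <= (p R T * u (nodes T))%:E)%E.
  by rewrite lee_fin p_shape_prob mulr_ge0 ?shape_prob_ge0.
have m0 n : (0 <= (shape_mass A n * u n)%:E)%E.
  by rewrite lee_fin mulr_ge0 ?sumr_ge0// => T _; exact: shape_prob_ge0.
rewrite nneseries_esumT//.
have {1}-> : A = \bigcup_(n in [set: nat]) (A `&` [set` trees n]).
  apply/seteqP; split=> T; last by case=> n _ [].
  by move=> AT; exists (nodes T) => //; split; rewrite //= mem_trees.
rewrite esum_bigcupT//; last first.
  move=> m n _ _ [T [[_ /= Tm] [_ /= Tn]]].
  by move: Tm Tn; rewrite !mem_trees => /eqP <- /eqP.
apply: eq_esum => n _; rewrite esum_trees// /shape_mass mulr_suml -sumEFin.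
rewrite big_seq_cond [RHS]big_seq_cond; apply: eq_bigr => T /andP[].
by rewrite mem_trees => /eqP -> _; rewrite p_shape_prob.
Qed.

Lemma shape_mass_expansions t : shape_mass (expansions t) = compress_prob R t.
Proof.
apply/funext => n; rewrite /shape_mass /compress_prob /Ebst big_mkcond.
apply: eq_bigr => T _; have -> : (T \in expansions t) = (compress T == t).
  by apply/idP/eqP => [/set_mem|/mem_set].
by case: ifP; rewrite ?mulr1 ?mulr0.
Qed.

(** Induction on t, starting at the empty tree, whose sequence is 1, 0, 0, ...; each step solves the
    recursion with the convolution of the subtrees as source. *)
Lemma exp_bounded_compress_prob t : empty_or_full t ->
  exp_bounded (compress_prob R t).
Proof.
elim: t => [|l IHl r IHr] ft.
  exists 1, 1; split=> // n; rewrite compress_prob_empty.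
  by case: n => [|n]; rewrite ?normr1 ?normr0 ?divr1 ?mul1r ?expr1n.
have [fl fr _] := empty_or_full_Node ft.
apply: exp_bounded_rec (exp_bounded_cauchy_prod (IHl fl) (IHr fr)) _ => n.
exact: compress_probS.
Qed.

Section expansions_of.
Variables (t : bintree) (x : R).
Hypothesis t_full : empty_or_full t.

(** Applied to |x|^n and to the positive and negative parts of x^n. *)
Let cvg_dominated (u : nat -> R) : (forall n, 0 <= u n <= `|x| ^+ n) ->
  cvgn (series (fun n => shape_mass (expansions t) n * u n)).
Proof.
move=> ux; rewrite shape_mass_expansions.
have := exp_bounded_norm_cvg (x := x) (exp_bounded_compress_prob t_full).
apply: series_le_cvg => n.
- by have /andP[? _] := ux n; rewrite mulr_ge0 ?compress_prob_ge0.
- by rewrite mulr_ge0 ?exprn_ge0.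
- have /andP[u0 un] := ux n.
  by rewrite /= ger0_norm ?compress_prob_ge0// ler_wpM2l ?compress_prob_ge0.
Qed.

Lemma summable_expansions : summable (expansions t) (fun T => (F T x)%:E).
Proof.
rewrite /summable; under eq_esum => T _.
  rewrite /= /F normrM normrX ger0_norm ?p_shape_prob ?shape_prob_ge0//.
  rewrite -p_shape_prob; over.
rewrite (@esum_by_nodes _ (fun n => `|x| ^+ n)) ?ltry//.
by apply: cvg_dominated => n; rewrite exprn_ge0 /=.
Qed.

Lemma G_psum : G t x = psum (compress_prob R t) x.
Proof.
have p0 T : 0 <= p R T by rewrite p_shape_prob shape_prob_ge0.
(* As [p R T] is nonnegative, the parts of [F T x] are those of x^n weighted by it; each gives a
   nonnegative series in n, and their difference restores x^n. *)
pose up n := Num.max (x ^+ n) 0; pose um n := Num.max (- x ^+ n) 0.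
have up_x n : 0 <= up n <= `|x| ^+ n.
  by rewrite le_max lexx orbT ge_max -normrX ler_norm normr_ge0.
have um_x n : 0 <= um n <= `|x| ^+ n.
  by rewrite le_max lexx orbT ge_max -normrX -normrN ler_norm normr_ge0.
rewrite /G /F_set.
have -> : (\esum_(T in expansions t) (fun T' => (F T' x)%:E)^\+ T =
    \esum_(T in expansions t) (p R T * up (nodes T))%:E)%E.
  apply: eq_esum => T _; rewrite funeposE /F /up -EFin_max.
  by rewrite maxr_pMr// mulr0.
have -> : (\esum_(T in expansions t) (fun T' => (F T' x)%:E)^\- T =
    \esum_(T in expansions t) (p R T * um (nodes T))%:E)%E.
  apply: eq_esum => T _; rewrite funenegE /F /um -EFinN -EFin_max.
  by rewrite maxr_pMr// mulr0 mulrN.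
rewrite !esum_by_nodes; try exact: cvg_dominated.
- rewrite -EFinB /= -limB; try exact: cvg_dominated.
  congr (limn _); rewrite -shape_mass_expansions; apply/funext => n.
  rewrite fctE /pseries /series /= -sumrB; apply: eq_bigr => i _.
  rewrite -mulrBr; congr (_ * _); rewrite /up /um.
  by case: (leP (x ^+ i) 0) => xi; case: leP => //; lra.
- by move=> n; case/andP: (um_x n).
- by move=> n; case/andP: (up_x n).
Qed.

End expansions_of.

End generating_functions.

(** * From the limit law to the limit of the means *)

Section mean_of_limit.
Variable R : realType.

(** As a random variable on mu, its cdf gives the measure of half-lines. *)
Let idR : measurableTypeR R -> R := idfun.

#[local] HB.instance Definition _ :=
  @isMeasurableFun.Build _ _ _ _ idR (@measurable_id _ _ setT).

Lemma tight (mu : probability (measurableTypeR R) R) (e : R) : 0 < e ->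
  exists M : R, [/\ 0 < M, fine (mu `]-oo, - M]%classic) < e
                  & 1 - e < fine (mu `]-oo, M]%classic)].
Proof.
move=> e0; pose X : {RV mu >-> R} := idR.
have cdfE r : cdf X r = mu `]-oo, r]%classic by [].
have [/= _ /cvgrPdist_lt/(_ e e0)[M1 [_ M1P]]] :=
  (fine_cvgP _ _).1 (cvg_cdfy1 X).
have [/= _ /cvgrPdist_lt/(_ e e0)[M2 [_ M2P]]] :=
  (fine_cvgP _ _).1 (cvg_cdfNy0 X).
exists (`|M1| + `|M2| + 1); split.
- by rewrite ltr_wpDl// addr_ge0.
- have /M2P /= : - (`|M1| + `|M2| + 1) < M2.
    by have := ler_norm (- M2); rewrite normrN; have := normr_ge0 M1; lra.
  by rewrite cdfE sub0r normrN; exact: le_lt_trans (ler_norm _).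
- have /M1P /= : M1 < `|M1| + `|M2| + 1.
    by have := ler_norm M1; have := normr_ge0 M2; lra.
  by rewrite cdfE ltr_norml => /andP[_]; rewrite ltrBlDr addrC -ltrBlDr.
Qed.

(** The point 0 is excluded because the law is the Dirac mass there when sigma = 0. *)
Lemma centred_normal_set1 (sigma x : R) : x != 0 ->
  centred_normal sigma [set x] = 0%E.
Proof.
move=> x0; rewrite /centred_normal; case: eqP => _ /=.
  by rewrite diracE memNset//= => x0'; rewrite -x0' eqxx in x0.
have nx : lebesgue_measure.-null_set [set x : R].
  by apply/measure0_null_setP => //; exact: lebesgue_measure_set1.
exact: (normal_prob_dominates 0 sigma nx).
Qed.

Lemma norm_Ebst_le n (f : bintree -> R) :
  `|Ebst n f| <= Ebst n (fun T => `|f T|).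
Proof.
apply: le_trans (ler_norm_sum _ _ _) _; apply: ler_sum => T _.
by rewrite normrM ger0_norm ?shape_prob_ge0.
Qed.

Lemma cdf_rescaled_count t b n x :
  fine (cdf (rescaled_count t b n : {RV (BST R n) >-> R}) x) =
  Ebst n (fun T => (rescaled_count t b n T <= x)%R%:R).
Proof.
rewrite /cdf /= /pushforward BST_mass /= /shape_mass big_mkcond.
apply: eq_bigr => T _.
have -> : (T \in rescaled_count t b n @^-1` `]-oo, x]%classic) =
    (rescaled_count t b n T <= x).
  by apply/idP/idP => [/set_mem|xT]; [|apply: mem_set]; rewrite /= in_itv.
by case: ifP; rewrite ?mulr1 ?mulr0.
Qed.

(** The mean of |N/n - b| is bounded directly: the integrand is at most M / sqrt n where the
    rescaled count lies between -M and M, and at most B elsewhere, an event of small probability by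
    tightness of the limit law. *)
Lemma hat_beta_mean_count t b : is_hat_beta t b ->
  mean_count R t n.+1 / n.+1%:R @[n --> \oo] --> b.
Proof.
move=> [sigma Xmu]; rewrite (cvg_shiftS (fun n => mean_count R t n / n%:R)).
apply/cvgrPdist_le => e e0.
(* B bounds |N/n - b| because N/n is in [0, 1]. Each tail will have probability below 2 d, so with d
   = e / (8 B) the two cost at most e / 2. *)
pose B := 1 + `|b|; have B0 : 0 < B by rewrite ltr_pwDl.
pose d := e / (8 * B); have d0 : 0 < d by rewrite divr_gt0// mulr_gt0.
have [M [M0 MN MP]] := tight (centred_normal sigma) d0.
have cvgX x : x != 0 ->
    Ebst n (fun T => (rescaled_count t b n T <= x)%R%:R) @[n --> \oo] -->
    fine (centred_normal sigma `]-oo, x]%classic).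
  move=> /(centred_normal_set1 sigma)/Xmu.
  rewrite -[X in _ --> X]fineK ?fin_num_measure// => /fine_cvgP[_].
  by apply: cvg_trans; apply: near_eq_cvg; near=> n; rewrite /= cdf_rescaled_count.
have NM0 : - M != 0 by rewrite oppr_eq0 gt_eqF.
have M0' : M != 0 by rewrite gt_eqF.
have /cvgrPdist_lt/(_ d d0) nearN := cvgX _ NM0.
have /cvgrPdist_lt/(_ d d0) nearP := cvgX _ M0'.
near=> n.
have n0 : (0 < n)%N by near: n; exact: nbhs_infty_gt.
have nR : 0 < n%:R :> R by rewrite ltr0n.
have sn0 : 0 < Num.sqrt n%:R :> R by rewrite sqrtr_gt0.
have sn : M / Num.sqrt n%:R <= e / 2.
  rewrite ler_pdivrMr// mulrC -ler_pdivrMr ?divr_gt0//.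
  rewrite -(@ger0_norm _ (M / (e / 2))); last by rewrite divr_ge0 ?divr_ge0 ?ltW.
  rewrite -sqrtr_sqr ler_wsqrtr//; near: n; exact: nbhs_infty_ger.
(* One d comes from the tail of the limit law, the other from the convergence of the cdf. *)
have En : Ebst n (fun T => (rescaled_count t b n T <= - M)%R%:R) < 2 * d.
  have : `|fine (centred_normal sigma `]-oo, - M]%classic)
     - Ebst n (fun T => (rescaled_count t b n T <= - M)%R%:R)| < d by near: n.
  by rewrite ltr_norml => /andP[]; move: MN; set u := fine _; set v := Ebst _ _; lra.
have Ep : 1 - 2 * d < Ebst n (fun T => (rescaled_count t b n T <= M)%R%:R).
  have : `|fine (centred_normal sigma `]-oo, M]%classic)
     - Ebst n (fun T => (rescaled_count t b n T <= M)%R%:R)| < d by near: n.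
  by rewrite ltr_norml => /andP[]; move: MP; set u := fine _; set v := Ebst _ _; lra.
have -> : b - mean_count R t n / n%:R =
    - Ebst n (fun T => n%:R^-1 * (N t (compress T))%:R + - b).
  by rewrite EbstD Ebst_cst EbstZ /mean_count; ring.
rewrite normrN; apply: le_trans (norm_Ebst_le _ _) _.
pose f T : R := M / Num.sqrt n%:R + B *
  ((rescaled_count t b n T <= - M)%R%:R
   + (1 + -1 * (rescaled_count t b n T <= M)%R%:R)).
apply: (@le_trans _ _ (Ebst n f)); last first.
  rewrite EbstD Ebst_cst EbstZ 2!EbstD Ebst_cst EbstZ.
  set v := Ebst _ _ in En *; set w := Ebst _ _ in Ep *.
  have : B * (v + (1 + -1 * w)) <= B * (4 * d) by rewrite ler_pM2l//; lra.
  have -> : B * (4 * d) = e / 2 by rewrite /d; field; rewrite gt_eqF.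
  by move: sn; lra.
apply: le_Ebst => T Tn; rewrite /f.
have xE : n%:R^-1 * (N t (compress T))%:R + - b =
    rescaled_count t b n T / Num.sqrt n%:R.
  rewrite /rescaled_count -mulrA -invfM -expr2 sqr_sqrtr ?ler0n//.
  by field; rewrite gt_eqF.
have xB : `|n%:R^-1 * (N t (compress T))%:R + - b| <= B.
  apply: le_trans (ler_normD _ _) _; rewrite normrN lerD2r.
  rewrite ger0_norm ?mulr_ge0// mulrC ler_pdivrMr// mul1r ler_nat -Tn.
  exact: N_compress_le.
have sM0 : 0 <= M / Num.sqrt n%:R by rewrite divr_ge0 ?ltW.
have [xN|xN] := leP (rescaled_count t b n T) (- M).
  have -> : rescaled_count t b n T <= M.
    by apply: le_trans xN _; rewrite lerNl ge0_cp// ltW.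
  by move: xB sM0; lra.
have [xP|xP] := leP (rescaled_count t b n T) M; last by move: xB sM0; lra.
rewrite add0r mulr1 subrr mulr0 addr0 xE normrM normfV (gtr0_norm sn0).
by rewrite ler_wpM2r ?invr_ge0 ?sqrtr_ge0// ler_norml ltW.
Unshelve. all: by end_near. Qed.

End mean_of_limit.

(** * The theorem *)

(** Corrects the denominator n + 2 of [mean_countE] to n + 1. *)
Lemma succ_ratio_cvg (R : realType) :
  (n.+2%:R / n.+1%:R : R) @[n --> \oo] --> (1 : R).
Proof.
have : 1 + @harmonic R n @[n --> \oo] --> (1 + 0 : R).
  by apply: cvgD; [exact: cvg_cst|exact: cvg_harmonic].
rewrite addr0; apply: cvg_trans; apply: near_eq_cvg; near=> n.
by rewrite /harmonic /= -(nat1r n.+1) mulrDl mul1r divff ?pnatr_eq0// addrC.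
Unshelve. all: by end_near. Qed.

(** * Integral formulas in terms of the two root subtrees *)

Section full_tree.
Variables (R : realType) (tL tR : bintree).
Hypothesis t_full : empty_or_full (Node tL tR).

Let h : nat -> R := cauchy_prod (compress_prob R tL) (compress_prob R tR).

Let h_bounded : exp_bounded h.
Proof.
have [fL fR _] := empty_or_full_Node t_full.
exact: exp_bounded_cauchy_prod (exp_bounded_compress_prob R fL)
  (exp_bounded_compress_prob R fR).
Qed.

Let psum_h x : psum h x = G tL x * G tR x.
Proof.
have [fL fR _] := empty_or_full_Node t_full.
by rewrite psum_cauchy_prod ?G_psum//; exact: exp_bounded_compress_prob.
Qed.

Lemma G_Node (x : R) : G (Node tL tR) x =
  oriented_integral 0 x (fun y => G tL y * G tR y * expR (2 * (x - y))).
Proof.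
rewrite G_psum// (psum_rec_integral x h_bounded (compress_prob0 R tL tR)).
  by congr oriented_integral; apply/funext => y; rewrite psum_h.
by move=> n; exact: compress_probS.
Qed.

Lemma mean_count_cvg : mean_count R (Node tL tR) n.+1 / n.+1%:R @[n --> \oo] -->
  \int[lebesgue_measure]_(x in `[0, 1]) ((1 - x) ^+ 2 * G tL x * G tR x).
Proof.
rewrite (_ : Rintegral _ _ _ = \int[lebesgue_measure]_(x in `[0, 1])
    ((1 - x) ^+ 2 * psum h x)); last first.
  by congr Rintegral; apply/funext => x; rewrite psum_h mulrA.
have hv : h n / (n.+1%:R * n.+2%:R) @[n --> \oo] --> 0.
  have hv : @harmonic R n.+1 @[n --> \oo] --> 0.
    by rewrite (cvg_shiftS (@harmonic R)); exact: cvg_harmonic.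
  apply: squeeze_cvgr (cvg_cst 0) hv; near=> n.
  have h0 : 0 <= h n by apply: sumr_ge0 => i _; rewrite mulr_ge0 ?compress_prob_ge0.
  (* The recursion bounds h(n) by n + 1 times a probability, so the boundary term is at most
     1/(n+2). *)
  have hn : h n <= n.+1%:R.
    have := compress_probS R n t_full; rewrite -/(h n) => E.
    apply: (@le_trans _ _ (n.+1%:R * compress_prob R (Node tL tR) n.+1)).
      by rewrite E lerDr mulr_ge0 ?compress_prob_ge0.
    by rewrite ler_piMr ?compress_prob_le1.
  rewrite divr_ge0 ?mulr_ge0//= invfM mulrA ler_piMl//.
  by rewrite ler_pdivrMr ?mul1r.
have := cvgM (cvgD hv (integral_sqr_psum h_bounded)) (@succ_ratio_cvg R).
move=> /(_ _ _); rewrite add0r mulr1; apply: cvg_trans; apply: near_eq_cvg; near=> n.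
rewrite /= !fctE /= -(mean_countE R n t_full) mulrA divfK// pnatr_eq0//.
Unshelve. all: by end_near. Qed.

End full_tree.

(** * Closed forms for the one-node tree *)

Section one_node.
Variable R : realType.

Let delta_prod n :
  cauchy_prod (compress_prob R Defs.Empty) (compress_prob R Defs.Empty) n =
  (n == 0%N)%:R.
Proof.
rewrite /cauchy_prod big_ord_recl big1 => [|i _].
  by rewrite addr0 !compress_prob_empty mul1r subn0.
by rewrite compress_prob_empty mul0r.
Qed.

Lemma G_bullet (x : R) : G bullet x = 2^-1 * (expR (2 * x) - 1).
Proof.
have bf : empty_or_full bullet by [].
pose e n : R := 2 ^+ n / n`!%:R.
(* The solution of the recursion with source 1, 0, 0, ...: 2^n / (2 n!) for n > 0, corrected to 0 at
   n = 0. *)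
have gE n : compress_prob R bullet n =
    2^-1 * e n + - 2^-1 * compress_prob R Defs.Empty n.
  rewrite compress_prob_empty; elim: n => [|n IH].
    by rewrite compress_prob0 /e expr0 divr1 !mulr1 subrr.
  apply: (mulfI (x := n.+1%:R)); first by rewrite pnatr_eq0.
  rewrite compress_probS// IH delta_prod /e exprS factS natrM.
  case: (n == 0%N) => /=; field;
    by rewrite nat1r !pnatr_eq0 -lt0n fact_gt0.
have eb : exp_bounded e.
  by exists 1, 2; split=> // n; rewrite mul1r ger0_norm// divr_ge0 ?exprn_ge0.
have db : exp_bounded (compress_prob R Defs.Empty).
  exact: exp_bounded_compress_prob.
rewrite G_psum// (funext gE).
rewrite psumD ?psumZ//; [|exact: exp_boundedZ|exact: exp_boundedZ].
have -> : psum e x = expR (2 * x).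
  congr (limn _); apply/funext => n; apply: eq_bigr => i _.
  by rewrite /e /exp_coeff /= exprMn mulrAC.
have -> : psum (compress_prob R Defs.Empty) x = 1.
  apply/cvg_lim => //; rewrite -cvg_shiftS /=; apply: cvg_near_cst; near=> n.
  rewrite /pseries /series /= big_nat_recl// compress_prob_empty expr0 mulr1.
  by rewrite big1 ?addr0// => i _; rewrite compress_prob_empty mul0r.
by ring.
Unshelve. all: by end_near. Qed.

Lemma mean_count_bullet_cvg :
  mean_count R bullet n.+1 / n.+1%:R @[n --> \oo] --> (3^-1 : R).
Proof.
have : 3^-1 * (n.+2%:R / n.+1%:R) @[n --> \oo] --> (3^-1 * 1 : R).
  by apply: cvgMr; exact: succ_ratio_cvg.
rewrite mulr1; apply: cvg_trans; apply: near_eq_cvg; near=> n.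
(* For n > 0 the boundary term vanishes and only k = 0 remains in the sum, with value 2/(1*2*3) =
   1/3; the mean at n + 1 is exactly (n+2)/3. *)
have n0 : (0 < n)%N by near: n; exact: nbhs_infty_gt.
have bf : empty_or_full bullet by [].
have := mean_countE R n bf; rewrite /= delta_prod gtn_eqF// mul0r add0r.
rewrite big_ltn// big_nat_cond big1 => [|k /andP[/andP[k0 _] _]]; last first.
  by rewrite delta_prod gtn_eqF// mul0r mulr0.
rewrite addr0 delta_prod => E.
have -> : mean_count R bullet n.+1 = n.+2%:R / 3.
  by rewrite -[LHS](@divfK _ n.+2%:R) ?pnatr_eq0// E /=; field.
by ring.
Unshelve. all: by end_near. Qed.

End one_node.

Theorem theorem5p13 (R : realType) (t : bintree) (t_full : is_full t) :
  [/\ forall x : R, summable (expansions t) (fun T => (F T x)%:E),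
      t = bullet ->
        forall x : R, G t x = 2^-1 * (expR (2 * x) - 1)
    & forall tL tR : bintree, (1 < nodes t)%N -> t = Node tL tR ->
        forall x : R, G t x =
          oriented_integral 0 x (fun y => G tL y * G tR y * expR (2 * (x - y)))]
  /\
  forall b : R, is_hat_beta t b ->
    (t = bullet -> b = 3^-1) /\
    (forall tL tR : bintree, (1 < nodes t)%N -> t = Node tL tR ->
       b = \int[lebesgue_measure]_(x in `[0, 1])
             ((1 - x) ^+ 2 * G tL x * G tR x)).
Proof.
have tf : empty_or_full t by rewrite /empty_or_full t_full orbT.
split; first split.
- by move=> x; exact: summable_expansions.
- by move=> -> x; exact: G_bullet.
- by move=> tL tR _ tE x; rewrite tE in tf *; exact: G_Node.
(* Both b and the explicit value are limits of the same sequence of normalized means. *)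
move=> b /hat_beta_mean_count bt; split=> [tE|tL tR _ tE]; subst t.
- exact: (cvg_unique _ bt (@mean_count_bullet_cvg R)).
- exact: (cvg_unique _ bt (@mean_count_cvg R _ _ tf)).
Qed.
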